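(* Let $(A,\mu_{\alpha,\beta},p_\omega,q_\omega)_{\alpha,\beta,\omega\in\Omega}$ be a BiHom-$\Omega$-associative algebra and $\mu=(\mu_{\alpha,\beta})_{\alpha,\beta\in\Omega}$. Define an operation on $\mathrm{C}^{\bullet+1}_\Omega(A)=\bigoplus_{n\ge0}\mathrm{C}^{n+1}_\Omega(A)$ by $$\delta_{\mathrm{alg}}(f):=(-1)^{|f|}[\mu,f]^\Omega_G.$$ Then $\delta_{\mathrm{alg}}$ is a differential (i.e. $\delta_{\mathrm{alg}}\circ\delta_{\mathrm{alg}}=0$). Moreover, $\delta_{\mathrm{alg}}$ is exactly the coboundary operator of the BiHom-$\Omega$-associative algebra $A$ (with coefficients in the regular bimodule): for all $n\ge1$, $f\in\mathrm{C}^n_\Omega(A)$, $a_1,\dots,a_{n+1}\in A$ and $\alpha_1,\dots,\alpha_{n+1}\in\Omega$, one has $\delta_{\mathrm{alg}}(f)_{\alpha_1,\dots,\alpha_{n+1}}(a_1,\dots,a_{n+1})=(\delta^n_{\mathrm{Alg}}f)_{\alpha_1,\dots,\alpha_{n+1}}(a_1,\dots,a_{n+1})$.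
   Context: $\mathbf{k}$ is a commutative unitary ring (the base ring for all vector spaces and linear maps) and $\Omega$ is a semigroup with unit $1$. Two families of linear endomorphisms $(p_\omega),(q_\omega)$ are commuting if $p_\alpha\circ q_\beta=q_\beta\circ p_\alpha$ for all $\alpha,\beta\in\Omega$. A BiHom-$\Omega$-associative algebra $(A,\mu_{\alpha,\beta},p_\omega,q_\omega)$ is a vector space $A$ with two commuting families of linear maps $p_\omega,q_\omega:A\to A$ and bilinear maps $\mu_{\alpha,\beta}:A\otimes A\to A$ such that for all $x,y,z\in A$, $\alpha,\beta,\gamma\in\Omega$: $p_{\alpha\beta}\mu_{\alpha,\beta}(x,y)=\mu_{\alpha,\beta}(p_\alpha(x),p_\beta(y))$, $q_{\alpha\beta}\mu_{\alpha,\beta}(x,y)=\mu_{\alpha,\beta}(q_\alpha(x),q_\beta(y))$, $\mu_{\alpha,\beta\gamma}(p_\alpha(x),\mu_{\beta,\gamma}(y,z))=\mu_{\alpha\beta,\gamma}(\mu_{\alpha,\beta}(x,y),q_\gamma(z))$. For $n\ge1$, $\mathrm{C}^n_\Omega(A)$ is the space of families $f=(f_{\alpha_1,\dots,\alpha_n}:A^{\otimes n}\to A)_{\alpha_1,\dots,\alpha_n\in\Omega}$ of multilinear maps with $p_{\alpha_1\cdots\alpha_n}\circ f_{\alpha_1,\dots,\alpha_n}=f_{\alpha_1,\dots,\alpha_n}\circ(p_{\alpha_1},\dots,p_{\alpha_n})$ and $q_{\alpha_1\cdots\alpha_n}\circ f_{\alpha_1,\dots,\alpha_n}=f_{\alpha_1,\dots,\alpha_n}\circ(q_{\alpha_1},\dots,q_{\alpha_n})$.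 An element $f\in\mathrm{C}^n_\Omega(A)$ has degree $|f|=n-1$. For $f\in\mathrm{C}^n_\Omega(A)$, $g\in\mathrm{C}^m_\Omega(A)$, $1\le i\le n$, define $f\diamond^\Omega_i g\in\mathrm{C}^{n+m-1}_\Omega(A)$ by $$(f\diamond^\Omega_i g)_{\alpha_1,\dots,\alpha_{n+m-1}}=f_{\alpha_1,\dots,\alpha_{i-1},\alpha_i\cdots\alpha_{i+m-1},\alpha_{i+m},\dots,\alpha_{n+m-1}}\big(p^{m-1}_{\alpha_1},\dots,p^{m-1}_{\alpha_{i-1}},g_{\alpha_i,\dots,\alpha_{i+m-1}},q^{m-1}_{\alpha_{i+m}},\dots,q^{m-1}_{\alpha_{n+m-1}}\big),$$ where powers denote iterated composition, and $$[f,g]^\Omega_G=\sum_{i=1}^n(-1)^{(m-1)(i-1)}f\diamond^\Omega_i g-(-1)^{(n-1)(m-1)}\sum_{i=1}^m(-1)^{(n-1)(i-1)}g\diamond^\Omega_i f.$$ The coboundary operator $\delta^n_{\mathrm{Alg}}:\mathrm{C}^n_\Omega(A)\to\mathrm{C}^{n+1}_\Omega(A)$, $n\ge1$, is $$(\delta^n_{\mathrm{Alg}}f)_{\alpha_1,\dots,\alpha_{n+1}}(a_1,\dots,a_{n+1})=\mu_{\alpha_1,\alpha_2\cdots\alpha_{n+1}}\big(p^{n-1}_{\alpha_1}(a_1),f_{\alpha_2,\dots,\alpha_{n+1}}(a_2,\dots,a_{n+1})\big)$$ $$+\sum_{i=1}^n(-1)^if_{\alpha_1,\dots,\alpha_i\alpha_{i+1},\dots,\alpha_{n+1}}\big(p_{\alpha_1}(a_1),\dots,p_{\alpha_{i-1}}(a_{i-1}),\mu_{\alpha_i,\alpha_{i+1}}(a_i,a_{i+1}),q_{\alpha_{i+2}}(a_{i+2}),\dots,q_{\alpha_{n+1}}(a_{n+1})\big)$$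 $$+(-1)^{n+1}\mu_{\alpha_1\cdots\alpha_n,\alpha_{n+1}}\big(f_{\alpha_1,\dots,\alpha_n}(a_1,\dots,a_n),q^{n-1}_{\alpha_{n+1}}(a_{n+1})\big).$$ *)

(* Defs.v *)
From HB Require Import structures.
From mathcomp Require Import all_boot all_order all_algebra zify.
From mathcomp Require Import boolp functions.

Set Implicit Arguments.
Unset Strict Implicit.
Unset Printing Implicit Defensive.

Import GRing.Theory.
Local Open Scope ring_scope.

Record bihom_algebra (k : comPzRingType) (Omega : monoidType)
    (A : lmodType k) := BihomAlgebra {
  bh_p : Omega -> {linear A -> A};
  bh_q : Omega -> {linear A -> A};
  bh_mu : Omega -> Omega -> A -> A -> A;
  bh_mu_linl : forall al be y, linear (fun x => bh_mu al be x y);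
  bh_mu_linr : forall al be x, linear (fun y => bh_mu al be x y);
  bh_pq : forall al be x, bh_p al (bh_q be x) = bh_q be (bh_p al x);
  bh_p_mu : forall al be x y,
    bh_p (al * be)%g (bh_mu al be x y) = bh_mu al be (bh_p al x) (bh_p be y);
  bh_q_mu : forall al be x y,
    bh_q (al * be)%g (bh_mu al be x y) = bh_mu al be (bh_q al x) (bh_q be y);
  bh_mu_assoc : forall al be ga x y z,
    bh_mu al (be * ga)%g (bh_p al x) (bh_mu be ga y z) =
    bh_mu (al * be)%g ga (bh_mu al be x y) (bh_q ga z) }.

(* The ordered product al_1 ... al_n of a tuple in a (noncommutative) monoid. *)
Definition mprod (Omega : monoidType) n (al : 'I_n -> Omega) : Omega :=
  (\big[*%g/1]_(j < n) al j)%g.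

(* Tuples are functions on 'I_n, so that positions are counted from 0.        *)
(* For x = (x_0, ..., x_N), block i m x is (x_i, ..., x_(i+m-1)), and         *)
(* splice i m l b r is (l_0, ..., l_(i-1), b, r_(i+m+1), ..., r_N): the m+1   *)
(* entries at i, ..., i+m are replaced by the single entry b. The length of   *)
(* the result is read off the type expected by the context; inord only ever   *)
(* receives indices <= N as long as i + m <= N + 1 for block, and i + m <= N  *)
(* with a result of length N + 1 - m for splice.                              *)
Definition block (T : Type) N (i m : nat) (x : 'I_N.+1 -> T) : 'I_m -> T :=
  fun j => x (inord (i + j)).
Arguments block {T N} i m x _.

Definition splice (T : Type) n N (i m : nat) (l : 'I_N.+1 -> T) (b : T)
    (r : 'I_N.+1 -> T) : 'I_n -> T :=
  fun j => if (j < i)%N then l (inord j)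
           else if j == i :> nat then b
           else r (inord (j + m)).
Arguments splice {T n N} i m l b r _.

Lemma mprod_splice (Omega : monoidType) (n m N i : nat)
    (al : 'I_N.+1 -> Omega) : (n + m)%N = N -> (i <= n)%N ->
  mprod (splice i m al (mprod (block i m.+1 al)) al : 'I_n.+1 -> Omega) =
  mprod al.
Proof.
move=> eN le_in; rewrite /mprod /splice.
set b := (\big[_/_]_(j < m.+1) _)%g.
rewrite -(big_mkord xpredT (fun j => if (j < i)%N then al (inord j)
  else if j == i then b else al (inord (j + m)))) /=.
transitivity (\big[*%g/1%g]_(0 <= j < N.+1) al (inord j)); last first.
  by rewrite big_mkord; apply: eq_bigr => j _; rewrite inord_val.
rewrite (@big_cat_nat _ _ _ i) //=; last by lia.
rewrite [RHS](@big_cat_nat _ _ _ i) //=; last by lia.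
congr (_ * _)%g.
  by apply: eq_big_nat => j /andP[_ ->].
rewrite big_ltn ?ltnS // ltnn eqxx [RHS](@big_cat_nat _ _ _ (i + m).+1) /=; try lia.
congr (_ * _)%g.
  rewrite /b -(big_mkord xpredT (fun j => al (inord (i + j)))).
  have /(_ i) -> : forall s, \big[*%g/1%g]_(s <= j < (i + m).+1) al (inord j) =
    \big[*%g/1%g]_(0 + s <= j < (i + m).+1) al (inord j) by [].
  rewrite big_addn -addnS addKn.
  by apply: eq_bigr => j _; rewrite addnC.
have -> : N.+1 = (n.+1 + m)%N by lia.
rewrite -addSn big_addn addnK; apply: eq_big_nat => j /andP[lt_ij _].
by rewrite ltnNge ltnW // gtn_eqF.
Qed.

Section Cochains.
Variables (k : comPzRingType) (Omega : monoidType) (A : lmodType k).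
Variable B : bihom_algebra Omega A.

Local Notation family n := (('I_n -> Omega) -> ('I_n -> A) -> A).
Local Notation p := (bh_p B).
Local Notation q := (bh_q B).

Record is_cochain n (f : family n) : Prop := IsCochain {
  cochain_multilinear : forall al (a : 'I_n -> A) i,
    linear (fun x => f al [eta a with i |-> x]);
  cochain_p : forall al a,
    p (mprod al) (f al a) = f al (fun j => p (al j) (a j));
  cochain_q : forall al a,
    q (mprod al) (f al a) = f al (fun j => q (al j) (a j)) }.

Definition cochain_pred n : {pred family n} := [pred f | `[< is_cochain f >]].

(* The index is the arity: cochain n.+1 is in degree n for the bracket.      *)
Record cochain (n : nat) := Cochain {
  cochain_val :> family n;
  _ : cochain_val \in @cochain_pred n }.

HB.instance Definition _ n := [isSub for @cochain_val n].
HB.instance Definition _ n := [Choice of cochain n by <:].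

Lemma cochain_submod n : submod_closed (@cochain_pred n).
Proof.
split=> [|c f g /asboolP[fl fp fq] /asboolP[gl gp gq]]; apply/asboolP; split.
- by move=> al a i d x y; rewrite /= scaler0 addr0.
- by move=> al a; rewrite linear0.
- by move=> al a; rewrite linear0.
- move=> al a i d x y; rewrite /= !fctE /= fl gl.
  by rewrite !scalerDr !scalerA mulrC !addrA (addrAC _ _ (d *: _)).
- by move=> al a; rewrite !fctE linearP fp gp.
- by move=> al a; rewrite !fctE linearP fq gq.
Qed.

HB.instance Definition _ n :=
  GRing.isSubmodClosed.Build k (family n) (@cochain_pred n) (@cochain_submod n).
HB.instance Definition _ n := [SubChoice_isSubLmodule of cochain n by <:].

Lemma cochainP n (f : cochain n) : is_cochain f.
Proof. by case: f => f /= /asboolP. Qed.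

Lemma cochain_eqP n (f g : cochain n) :
  (forall al a, f al a = g al a) -> f = g.
Proof. by move=> fg; apply: val_inj; apply/funext=> al; apply/funext=> a; exact: fg. Qed.

Lemma mu_cochain :
  (fun al a => bh_mu B (al ord0) (al ord_max) (a ord0) (a ord_max))
    \in @cochain_pred 2.
Proof.
have m2 (al : 'I_2 -> Omega) : mprod al = (al ord0 * al ord_max)%g.
  rewrite /mprod big_ord_recl big_ord1.
  by congr (_ * al _)%g; apply: val_inj.
apply/asboolP; split=> [al a i c x y|al a|al a]; last 2 first.
- by rewrite m2 bh_p_mu.
- by rewrite m2 bh_q_mu.
case: (unliftP ord0 i) => [j ->|->] /=.
  by rewrite ord1 -[lift _ _]/(lift ord0 ord0) (_ : lift _ _ = ord_max) ?eqxx
    ?bh_mu_linr //; apply: val_inj.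
exact: bh_mu_linl.
Qed.

Definition alg_mu : cochain 2 := Cochain mu_cochain.

(* The i-th composition, with i counted from 0. *)
Definition circ_family n m N (f : family n.+1) (g : family m.+1) (i : nat) :
    family N.+1 :=
  fun al a =>
    f (splice i m al (mprod (block i m.+1 al)) al)
      (splice i m (fun j => iter m (p (al j)) (a j))
                  (g (block i m.+1 al) (block i m.+1 a))
                  (fun j => iter m (q (al j)) (a j))).

Lemma iter_linear m (h : {linear A -> A}) : linear (iter m h).
Proof. by elim: m => [|m IH] c x y //=; rewrite IH linearP. Qed.

Lemma iterC m (h g : A -> A) x :
  (forall y, h (g y) = g (h y)) -> h (iter m g x) = iter m g (h x).
Proof. by move=> hg; elim: m => //= m IH; rewrite hg IH. Qed.

Lemma splice_upd (T : Type) n N i m (l r : 'I_N.+1 -> T) b b' (j : 'I_n) :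
    i = j ->
  splice i m l b r = [eta (splice i m l b' r : 'I_n -> T) with j |-> b].
Proof.
move=> -> ; apply/funext=> t; rewrite /= /splice -val_eqE /=.
by case: eqVneq => [->|//]; rewrite ltnn.
Qed.

Section Circ.
Variables (n m N : nat) (eN : (n + m)%N = N) (i : 'I_n.+1).

Lemma circ_linear_r (f : cochain n.+1) (g h : cochain m.+1) c
    (al : 'I_N.+1 -> Omega) (a : 'I_N.+1 -> A) :
  circ_family f (c *: g + h) i al a =
  c *: circ_family f g i al a + circ_family f h i al a.
Proof.
have upd l r b := @splice_upd A n.+1 N i m l r b 0 i erefl.
rewrite /circ_family (upd _ _ ((c *: g + h) _ _)) (upd _ _ (g _ _)).
rewrite (upd _ _ (h _ _)); exact: (cochain_multilinear (cochainP f)).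
Qed.

Lemma circ_linear_l (f g : cochain n.+1) (h : cochain m.+1) c
    (al : 'I_N.+1 -> Omega) (a : 'I_N.+1 -> A) :
  circ_family (c *: f + g) h i al a =
  c *: circ_family f h i al a + circ_family g h i al a.
Proof. by []. Qed.

Lemma circ_cochain (f : cochain n.+1) (g : cochain m.+1) :
  circ_family f g i \in @cochain_pred N.+1.
Proof.
have [fl fp fq] := cochainP f; have [gl gp gq] := cochainP g.
have le_in : (i <= n)%N by rewrite -ltnS.
apply/asboolP; split=> [al a j c x y|al a|al a].
- have eqo b (u : nat) (s : 'I_b.+1) : (u <= b)%N -> (inord u == s) = (u == s).
    by move=> le_ub; rewrite -val_eqE /= inordK.
  have eqo' b (u : nat) (s : 'I_b.+1) : (u <= b)%N -> (s == inord u) = (s == u :> nat).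
    by move=> le_ub; rewrite -val_eqE /= inordK.
  have lt_jN : (j <= N)%N by rewrite -ltnS.
  pose t z := splice i m
    (fun j1 => iter m (p (al j1)) ([eta a with j |-> z] j1))
    (g (block i m.+1 al) (block i m.+1 [eta a with j |-> z]))
    (fun j1 => iter m (q (al j1)) ([eta a with j |-> z] j1)) : 'I_n.+1 -> A.
  suff [b [h lh E]] : exists b, exists2 h : A -> A, linear h &
      forall z, t z = [eta t 0 with b |-> h z].
    pose be : 'I_n.+1 -> Omega := splice i m al (mprod (block i m.+1 al)) al.
    have fE z : circ_family f g i al [eta a with j |-> z] = f be (t z) by [].
    by rewrite !fE (E (c *: x + y)) (E x) (E y) lh; exact: fl.
  have [lt_ji|le_ij] := ltnP j i; last have [lt_imj|le_jim] := ltnP (i + m) j.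
  + exists (inord j), (iter m (p (al j))); first exact: iter_linear.
    move=> z; apply/funext=> s; have lt_sn : (s <= n)%N by rewrite -ltnS.
    have bl z' : block i m.+1 [eta a with j |-> z'] = block i m.+1 a.
      by apply/funext=> u; have := ltn_ord u => ?; rewrite /block /= eqo ?gtn_eqF //; lia.
    rewrite /t /splice /= !bl eqo'; last by lia.
    case: (ltnP s i) => [lt_si|le_is].
      rewrite eqo; last by lia.
      case: eqVneq => // sj; congr (iter m (p (al _)) z).
      by apply: val_inj; rewrite /= inordK ?sj //; lia.
    rewrite (_ : (s == j :> nat) = false); last by lia.
    case: eqVneq => // ne_si; rewrite eqo; last by lia.
    by rewrite (_ : (s + m == j)%N = false) //; lia.
  + exists (inord (j - m)), (iter m (q (al j))); first exact: iter_linear.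
    move=> z; apply/funext=> s; have lt_sn : (s <= n)%N by rewrite -ltnS.
    have bl z' : block i m.+1 [eta a with j |-> z'] = block i m.+1 a.
      by apply/funext=> u; have := ltn_ord u => ?; rewrite /block /= eqo ?ltn_eqF //; lia.
    rewrite /t /splice /= !bl eqo'; last by lia.
    case: (ltnP s i) => [lt_si|le_is].
      rewrite eqo; last by lia.
      rewrite (_ : (s == (j - m)%N :> nat) = false); last by lia.
      by rewrite (_ : (s == j :> nat) = false) //; lia.
    case: (eqVneq (s : nat) i) => [->|ne_si].
      by rewrite (_ : (i == (j - m)%N :> nat) = false) //; lia.
    rewrite eqo; last by lia.
    have -> : (s + m == j)%N = (s == (j - m)%N :> nat) by lia.
    case: eqVneq => // sj; congr (iter m (q (al _)) z).
    by apply: val_inj; rewrite /= inordK ?sj //; lia.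
  + exists i, (fun z => g (block i m.+1 al)
        [eta block i m.+1 a with inord (j - i) |-> z]); first exact: gl.
    move=> z; apply/funext=> s; have lt_sn : (s <= n)%N by rewrite -ltnS.
    have -> : ([eta block i m.+1 a with inord (j - i) |-> z] : 'I_m.+1 -> A) =
              block i m.+1 [eta a with j |-> z].
      apply/funext=> u; have ? := ltn_ord u.
      rewrite /block /= eqo' ?eqo; try lia.
      by have -> : (u == (j - i)%N :> nat) = (i + u == j)%N by lia.
    rewrite /t /splice /= -[s == i]val_eqE /=.
    case: (ltnP s i) => [lt_si|le_is].
      rewrite ltn_eqF // eqo; last by lia.
      by rewrite (_ : (s == j :> nat) = false) //; lia.
    case: eqVneq => // ne_si; rewrite eqo; last by lia.
    by rewrite (_ : (s + m == j)%N = false) //; lia.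
- rewrite /circ_family -(mprod_splice al eN le_in) fp; congr (f _ _).
  apply/funext=> s; rewrite /splice.
  case: ifP => _; first exact: iterC.
  case: ifP => _; first by rewrite gp.
  by apply: iterC => y; rewrite bh_pq.
- rewrite /circ_family -(mprod_splice al eN le_in) fq; congr (f _ _).
  apply/funext=> s; rewrite /splice.
  case: ifP => _; first by apply: iterC => y; rewrite bh_pq.
  case: ifP => _; first by rewrite gq.
  exact: iterC.
Qed.

Definition circ (f : cochain n.+1) (g : cochain m.+1) : cochain N.+1 :=
  Cochain (circ_cochain f g).
End Circ.

Lemma circ_linearr n m N (eN : (n + m)%N = N) i (f : cochain n.+1) :
  linear (circ eN i f : cochain m.+1 -> cochain N.+1).
Proof. by move=> c g h; apply: cochain_eqP => al a; exact: circ_linear_r. Qed.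

Lemma circ_linearl n m N (eN : (n + m)%N = N) i (g : cochain m.+1) :
  linear ((circ eN i)^~ g : cochain n.+1 -> cochain N.+1).
Proof. by move=> c f h; apply: cochain_eqP => al a; exact: circ_linear_l. Qed.

Definition bracket n m (f : cochain n.+1) (g : cochain m.+1) :
    cochain (n + m).+1 :=
  \sum_(i < n.+1) (-1) ^+ (m * i) *: circ (erefl (n + m)%N) i f g
  - (-1) ^+ (n * m) *:
    \sum_(i < m.+1) (-1) ^+ (n * i) *: circ (addnC m n) i g f.

Definition delta_alg n (f : cochain n.+1) : cochain n.+2 :=
  (-1) ^+ n *: bracket alg_mu f.

Lemma delta_alg_linear n : linear (@delta_alg n).
Proof.
move=> c f g; rewrite /delta_alg /bracket.
under eq_bigr do rewrite circ_linearr scalerDr scalerA mulrC -scalerA.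
under [X in _ *: (_ - _ *: X)]eq_bigr do
  rewrite circ_linearl scalerDr scalerA mulrC -scalerA.
rewrite !big_split /= -!scaler_sumr [X in _ *: (_ - X)]scalerDr scalerA.
rewrite [X in _ *: (_ - (X *: _ + _))]mulrC -scalerA opprD addrACA -scalerBr.
by rewrite scalerDr scalerA mulrC -scalerA.
Qed.

HB.instance Definition _ n :=
  GRing.isLinear.Build k (cochain n.+1) (cochain n.+2) _ (@delta_alg n)
    (@delta_alg_linear n).

Definition coboundary n (f : cochain n.+1) : family n.+2 :=
  fun al a =>
    bh_mu B (al ord0) (mprod (block 1 n.+1 al))
      (iter n (p (al ord0)) (a ord0)) (f (block 1 n.+1 al) (block 1 n.+1 a))
    + \sum_(i < n.+1) (-1) ^+ i.+1 *:
        f (splice i 1 al (al (inord i) * al (inord i.+1))%g al)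
          (splice i 1 (fun j => p (al j) (a j))
             (bh_mu B (al (inord i)) (al (inord i.+1))
                      (a (inord i)) (a (inord i.+1)))
             (fun j => q (al j) (a j)))
    + (-1) ^+ n.+2 *:
      bh_mu B (mprod (block 0 n.+1 al)) (al ord_max)
        (f (block 0 n.+1 al) (block 0 n.+1 a))
        (iter n (q (al ord_max)) (a ord_max)).

(* The direct sum of the modules cochain n.+1, for n >= 0. *)
Record cochain_sum := CochainSum {
  component : forall n, cochain n.+1;
  component_finite : exists N, forall n, (N <= n)%N -> component n = 0 }.

Lemma cochain_sum_eqP (x y : cochain_sum) :
  (forall n, component x n = component y n) -> x = y.
Proof.
case: x y => [x fx] [y fy] /= xy.
have exy : x = y by exact: functional_extensionality_dep.
by subst y; congr CochainSum; exact: Prop_irrelevance.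
Qed.

HB.instance Definition _ := gen_eqMixin cochain_sum.
HB.instance Definition _ := gen_choiceMixin cochain_sum.

Definition csum_zero : cochain_sum :=
  CochainSum (ex_intro _ 0%N (fun n _ => erefl (0 : cochain n.+1))).

Lemma csum_opp_finite (x : cochain_sum) :
  exists N, forall n, (N <= n)%N -> - component x n = 0.
Proof. by case: x => x [N xN]; exists N => n /xN /= ->; rewrite oppr0. Qed.

Lemma csum_add_finite (x y : cochain_sum) :
  exists N, forall n, (N <= n)%N -> component x n + component y n = 0.
Proof.
case: x y => [x [M xM]] [y [N yN]]; exists (maxn M N) => n /=.
by rewrite geq_max => /andP[/xM -> /yN ->]; rewrite addr0.
Qed.

Lemma csum_scale_finite (c : k) (x : cochain_sum) :
  exists N, forall n, (N <= n)%N -> c *: component x n = 0.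
Proof. by case: x => x [N xN]; exists N => n /xN /= ->; rewrite scaler0. Qed.

Definition csum_opp x := CochainSum (csum_opp_finite x).
Definition csum_add x y := CochainSum (csum_add_finite x y).
Definition csum_scale c x := CochainSum (csum_scale_finite c x).

Lemma csum_addA : associative csum_add.
Proof. by move=> x y z; apply: cochain_sum_eqP => n; exact: addrA. Qed.

Lemma csum_addC : commutative csum_add.
Proof. by move=> x y; apply: cochain_sum_eqP => n; exact: addrC. Qed.

Lemma csum_add0 : left_id csum_zero csum_add.
Proof. by move=> x; apply: cochain_sum_eqP => n; exact: add0r. Qed.

Lemma csum_addN : left_inverse csum_zero csum_opp csum_add.
Proof. by move=> x; apply: cochain_sum_eqP => n; exact: addNr. Qed.

HB.instance Definition _ := GRing.isZmodule.Build cochain_sum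
  csum_addA csum_addC csum_add0 csum_addN.

Lemma csum_scaleA c d x : csum_scale c (csum_scale d x) = csum_scale (c * d) x.
Proof. by apply: cochain_sum_eqP => n; exact: scalerA. Qed.

Lemma csum_scale1 : left_id 1 csum_scale.
Proof. by move=> x; apply: cochain_sum_eqP => n; exact: scale1r. Qed.

Lemma csum_scaleDr : right_distributive csum_scale +%R.
Proof. by move=> c x y; apply: cochain_sum_eqP => n; exact: scalerDr. Qed.

Lemma csum_scaleDl x : {morph csum_scale^~ x : c d / c + d}.
Proof. by move=> c d; apply: cochain_sum_eqP => n; exact: scalerDl. Qed.

HB.instance Definition _ := GRing.Zmodule_isLmodule.Build k cochain_sum
  csum_scaleA csum_scale1 csum_scaleDr csum_scaleDl.

Definition delta_sum_component (x : cochain_sum) n : cochain n.+1 :=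
  if n is n'.+1 then delta_alg (component x n') else 0.

Lemma delta_sum_finite (x : cochain_sum) :
  exists N, forall n, (N <= n)%N -> delta_sum_component x n = 0.
Proof.
case: x => x [N xN]; exists N.+1 => -[//|n] /xN /= ->; exact: linear0.
Qed.

(* The operation induced on the direct sum by delta_alg in each arity.       *)
Definition delta_sum (x : cochain_sum) : cochain_sum :=
  CochainSum (delta_sum_finite x).

Lemma delta_sum_linear : linear delta_sum.
Proof.
move=> c x y; apply: cochain_sum_eqP => -[|n] /=; last exact: linearP.
by rewrite [RHS]addr0 scaler0.
Qed.

HB.instance Definition _ :=
  GRing.isLinear.Build k cochain_sum cochain_sum _ delta_sum delta_sum_linear.
End Cochains.

(* Main.v *)
Require Import Defs.
From HB Require Import structures.
From mathcomp Require Import all_boot all_algebra.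
From mathcomp Require Import zify boolp.
Local Open Scope ring_scope.

Set Implicit Arguments.
Unset Strict Implicit.
Unset Printing Implicit Defensive.

Import GRing.Theory.

(** Write mu o_i f for the twisted partial composition. In the definition of
the bracket, |mu| = 1, so for f of arity n+1 the operator is
  mu o_1 f + sum_(i <= n) (-1)^(i+1) (f o_i mu) + (-1)^(n+2) (mu o_0 f),
that is, the alternating sum of n+3 maps d_0 f = mu o_1 f,
d_(i+1) f = f o_i mu and d_(n+2) f = mu o_0 f. Evaluating each d_i f gives the
terms of the coboundary operator ([delta_alg_cofaces] and the second half of
the theorem). The square vanishes because the d_i satisfy the cosimplicial
identities d_j d_i = d_i d_(j-1) for i < j ([coface_coface],
[coface_cochain_coface]), which make the terms of the double alternating sum
cancel in pairs ([alternating_double_sum]).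

The cosimplicial identities follow from three facts: the sequential and
parallel associativity of the partial compositions ([pcomp_seq],
[pcomp_par]), and mu o_0 mu = mu o_1 mu, which is BiHom-associativity.

The twists and the grading by Omega are handled by passing to sets. A family
f becomes a single operation on the set
T = Omega * A, sending (al_j, a_j)_j to (al_0 ... al_n, f_al(a)); the families p
and q become two commuting maps P, Q : T -> T, and the compatibility of f
with p and q says that the operation commutes with P and Q. The composition
then has a formula free of any index in Omega ([graded_circ]), and the
associativity laws hold for operations on any set with two commuting maps. *)

(** * Tuples *)

Lemma eq_tuple_inord (T : Type) n (x y : 'I_n.+1 -> T) :
  (forall j, (j <= n)%N -> x (inord j) = y (inord j)) -> x = y.
Proof.
by move=> xy; apply/funext=> j; rewrite -(inord_val j); apply: xy; rewrite -ltnS.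
Qed.

Lemma splice_inord (T : Type) n N i m (l : 'I_N.+1 -> T) b r j :
    (j <= n)%N ->
  (splice i m l b r : 'I_n.+1 -> T) (inord j) =
  if (j < i)%N then l (inord j) else if j == i then b else r (inord (j + m)).
Proof. by move=> le_jn; rewrite /splice inordK. Qed.

Lemma block_inord (T : Type) N i m (x : 'I_N.+1 -> T) j :
  (j <= m)%N -> block i m.+1 x (inord j) = x (inord (i + j)).
Proof. by move=> le_jm; rewrite /block inordK. Qed.

Lemma splice_map (T U : Type) (phi : T -> U) n N i m (l : 'I_N.+1 -> T) b r :
  (fun j => phi ((splice i m l b r : 'I_n -> T) j)) =
  splice i m (fun j => phi (l j)) (phi b) (fun j => phi (r j)).
Proof. by apply/funext=> j; rewrite /splice; case: ifP => // _; case: ifP. Qed.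

(** * Alternating double sums *)

(** The identity pairs the index (j, i) with i < j with (i, j - 1), of the
opposite sign. *)
Lemma alternating_double_sum (k : pzRingType) (V : lmodType k) n
    (X : nat -> nat -> V) :
    (forall i j, (i < j)%N -> (j <= n)%N -> X j i = X i j.-1) ->
  \sum_(j < n.+1) \sum_(i < n) (-1) ^+ (i + j) *: X j i = 0.
Proof.
move=> XE.
under eq_bigr => j _ do rewrite (bigID (fun i : 'I_n => (i < j)%N)) /=.
rewrite big_split /= big_ord_recl big_pred0 // add0r.
rewrite [X in _ + X]big_ord_recr /= [X in _ + (_ + X)]big_pred0 ?addr0; last first.
  by move=> i; rewrite ltn_ord.
rewrite (exchange_big_dep xpredT) //= -big_split big1 //= => i _.
apply/eqP; rewrite addr_eq0 -sumrN; apply/eqP; apply: eq_big => j.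
  by rewrite ltnS leqNgt.
move=> le_ij; rewrite XE //.
by rewrite [bump 0 j]add1n addnS exprS mulN1r scaleNr addnC.
Qed.

(** * Partial compositions of operations on a set with two commuting maps *)

Section PartialComposition.
Variables (T : Type) (P Q : T -> T).
Hypothesis PQ : forall x, P (Q x) = Q (P x).

Definition pcomp n m N (F : ('I_n.+1 -> T) -> T) (G : ('I_m.+1 -> T) -> T)
    (i : nat) : ('I_N.+1 -> T) -> T :=
  fun x => F (splice i m (fun j => iter m P (x j)) (G (block i m.+1 x))
                         (fun j => iter m Q (x j))).
Arguments pcomp {n m N} F G i _.

Definition commutes_with n (h : T -> T) (F : ('I_n.+1 -> T) -> T) :=
  forall x, h (F x) = F (fun j => h (x j)).

Lemma iter_commutes_with n h (F : ('I_n.+1 -> T) -> T) c :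
  commutes_with h F -> commutes_with (iter c h) F.
Proof. by move=> hF; elim: c => [|c IH] x //=; rewrite IH hF. Qed.

Lemma iter_PQ c d x : iter c P (iter d Q x) = iter d Q (iter c P x).
Proof.
elim: c => //= c ->; elim: d => //= d <-; exact: PQ.
Qed.

(** The twists agree term by term: on both sides an argument of F other than
the value of G receives the power m + l of P or Q, and an argument of G other
than the value of H receives the power l. *)
Lemma pcomp_seq n m l N1 M N (F : ('I_n.+1 -> T) -> T)
    (G : ('I_m.+1 -> T) -> T) (H : ('I_l.+1 -> T) -> T) i j :
    (n + m)%N = N1 -> (m + l)%N = M -> (n + M)%N = N ->
    (i <= n)%N -> (j <= m)%N ->
  pcomp (pcomp F G i : ('I_N1.+1 -> T) -> T) H (i + j) =
  pcomp F (pcomp G H j : ('I_M.+1 -> T) -> T) i :> (('I_N.+1 -> T) -> T).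
Proof.
move=> e1 e2 e3 le_in le_jm; apply/funext=> x; rewrite /pcomp; congr F.
apply: eq_tuple_inord => s le_sn; rewrite !splice_inord //=; try lia.
have [lt_si|le_is] := ltnP s i.
  by rewrite ltn_addr // -iterD e2.
case: eqVneq => [_|ne_si]; last first.
  rewrite (_ : (s + m < i + j)%N = false); last by lia.
  rewrite (_ : (s + m == i + j)%N = false); last by lia.
  by rewrite -iterD e2 -addnA e2.
congr G; apply: eq_tuple_inord => u le_um.
rewrite block_inord // !splice_inord //=; try lia.
rewrite ltn_add2l eqn_add2l.
have [lt_uj|le_ju] := ltnP u j.
  by rewrite block_inord //; lia.
case: eqVneq => [_|ne_uj].
  congr H; apply: eq_tuple_inord => v le_vl.
  by rewrite !block_inord ?addnA //; lia.
by rewrite block_inord ?addnA //; lia.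
Qed.

(** On the left the value of H receives P^m, which commutes past H to its
arguments; on the right the value of G receives Q^l, which commutes past G. An argument lying between the two
insertions receives Q from H and P from G, in the two possible orders. *)
Lemma pcomp_par n m l N1 N2 N (F : ('I_n.+1 -> T) -> T)
    (G : ('I_m.+1 -> T) -> T) (H : ('I_l.+1 -> T) -> T) i j :
    commutes_with Q G -> commutes_with P H ->
    (n + m)%N = N1 -> (n + l)%N = N2 -> (n + m + l)%N = N ->
    (i <= n)%N -> (j < i)%N ->
  pcomp (pcomp F G i : ('I_N1.+1 -> T) -> T) H j =
  pcomp (pcomp F H j : ('I_N2.+1 -> T) -> T) G (i + l)
    :> (('I_N.+1 -> T) -> T).
Proof.
move=> GQ HP e1 e2 e3 le_in lt_ji; apply/funext=> x; rewrite /pcomp; congr F.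
apply: eq_tuple_inord => s le_sn; rewrite !splice_inord //=; try lia.
have [lt_sj|le_js] := ltnP s j.
  rewrite (ltn_trans lt_sj lt_ji).
  by rewrite ltn_addr ?(ltn_trans lt_sj lt_ji) // -!iterD addnC.
case: (eqVneq s j) => [->|ne_sj].
  rewrite lt_ji (iter_commutes_with m HP); congr H.
  apply: eq_tuple_inord => v le_vl.
  rewrite !block_inord // splice_inord /=; last by lia.
  by rewrite ifT //; lia.
have [lt_si|le_is] := ltnP s i.
  rewrite ifT; last by lia.
  exact: iter_PQ.
rewrite ltn_add2r eqn_add2r (leq_gtF le_is).
case: (eqVneq s i) => [_|ne_si].
  rewrite (iter_commutes_with l GQ); congr G.
  apply: eq_tuple_inord => v le_vm.
  rewrite !block_inord // splice_inord /=; last by lia.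
  rewrite (_ : (i + v < j)%N = false); last by lia.
  rewrite (_ : (i + v == j)%N = false); last by lia.
  by rewrite addnAC.
rewrite (_ : (s + m < j)%N = false); last by lia.
rewrite (_ : (s + m == j)%N = false); last by lia.
by rewrite -!iterD addnC addnAC.
Qed.

(** * Cofaces defined by an associative operation *)

Variable M : ('I_2 -> T) -> T.
Hypotheses (MP : commutes_with P M) (MQ : commutes_with Q M).
Hypothesis MM :
  pcomp M M 0 = pcomp M M 1 :> (('I_3 -> T) -> T).

(** The terms of the Hochschild differential for the product M: the last and
the first coface are the actions of M on either side of F. *)
Definition coface n (i : nat) (F : ('I_n.+1 -> T) -> T) : ('I_n.+2 -> T) -> T :=
  if i is i'.+1 then if (i' <= n)%N then pcomp F M i' else pcomp M F 0
  else pcomp M F 1.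

(** If j = i + 1, or if i = 0 and j = n + 3, the two sides contain the two
different composites of M with itself, and associativity of M identifies them.
Every other case is a single instance of [pcomp_seq] or [pcomp_par]. *)
Lemma coface_coface n (F : ('I_n.+1 -> T) -> T) i j :
    commutes_with P F -> commutes_with Q F -> (i < j)%N -> (j <= n.+3)%N ->
  coface j (coface i F) = coface i (coface j.-1 F).
Proof.
move=> FP FQ lt_ij le_jn.
have M0 c N : N = n.+2 -> (c <= 1)%N ->
  pcomp (pcomp M M 0 : ('I_3 -> T) -> T) F c =
  pcomp M (pcomp M F c : ('I_n.+2 -> T) -> T) 0 :> (('I_N.+1 -> T) -> T).
  by move=> -> le_c1; rewrite -(@pcomp_seq 1 1 n 2 n.+1 n.+2 M M F 0 c).
have M1 c N : N = n.+2 -> (c <= 1)%N ->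
  pcomp (pcomp M M 1 : ('I_3 -> T) -> T) F c.+1 =
  pcomp M (pcomp M F c : ('I_n.+2 -> T) -> T) 1 :> (('I_N.+1 -> T) -> T).
  by move=> -> le_c1; rewrite -(@pcomp_seq 1 1 n 2 n.+1 n.+2 M M F 1 c).
case: i j lt_ij le_jn => [|i] [|[|j]] //= lt_ij le_jn.
- rewrite (@pcomp_par 1 n 1 n.+1 2 n.+2 M F M 1 0) //; last by lia.
  by rewrite MM M1.
- rewrite !ltnS in le_jn *.
  have [le_jn'|lt_nj] := leqP j n.
    by rewrite (@pcomp_seq 1 n 1 n.+1 n.+1 n.+2 M F M 1 j) //; lia.
  by rewrite -M0 // MM M1.
rewrite !ltnS in lt_ij le_jn *.
have [le_jn'|lt_nj] := leqP j n.
  have le_in := leq_trans lt_ij le_jn'.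
  rewrite le_in (leq_trans le_in) //.
  move: lt_ij; rewrite leq_eqVlt => /orP[/eqP <-|lt_ij].
    (* After M is inserted at i in F, its own two slots are i + 0 and i + 1. *)
    rewrite -{1}(addn1 i) -{4}(addn0 i).
    by rewrite !(@pcomp_seq n 1 1 n.+1 2 n.+2) ?MM //; lia.
  rewrite (@pcomp_par n 1 1 n.+1 n.+1 n.+2 F M M j i) //; try lia.
  by rewrite addn1.
have ej : j = n.+1 by lia.
have [le_in|lt_ni] := leqP i n.
  rewrite (leq_trans le_in) //.
  by rewrite -(@pcomp_seq 1 n 1 n.+1 n.+1 n.+2 M F M 0 i) //; lia.
have -> : i = n.+1 by lia.
rewrite leqnn -M0 // MM (@pcomp_par 1 1 n 2 n.+1 n.+2 M M F 1 0) //; lia.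
Qed.

End PartialComposition.

(** * Cofaces of cochains *)

Section CochainCofaces.
Variables (k : comPzRingType) (Omega : monoidType) (A : lmodType k).
Variable B : bihom_algebra Omega A.

Definition twist (h : Omega -> A -> A) (t : Omega * A) : Omega * A :=
  (t.1, h t.1 t.2).
Local Notation P := (twist (bh_p B)).
Local Notation Q := (twist (bh_q B)).

Lemma iter_twist h c t : iter c (twist h) t = (t.1, iter c (h t.1) t.2).
Proof. by elim: c => [|c /= ->]; case: t. Qed.

(** Keeping the product of the indices makes the result an element of
Omega * A again, so that such operations can be composed. *)
Definition graded n (f : ('I_n.+1 -> Omega) -> ('I_n.+1 -> A) -> A)
    (x : 'I_n.+1 -> Omega * A) : Omega * A :=
  (mprod (fun j => (x j).1), f (fun j => (x j).1) (fun j => (x j).2)).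

Lemma graded_inj n (f g : cochain B n.+1) : graded f = graded g -> f = g.
Proof.
move=> fg; apply: cochain_eqP => al a.
exact: (congr1 (fun F => (F (fun j => (al j, a j))).2) fg).
Qed.

Lemma graded_commutes n (f : cochain B n.+1) :
  commutes_with P (graded f) /\ commutes_with Q (graded f).
Proof.
have [_ fp fq] := cochainP f.
by split=> x; rewrite /twist /graded /= ?fp ?fq.
Qed.

(** The first components of the right-hand side multiply to the whole product
because a block is replaced by its own product. *)
Lemma graded_circ n m N (eN : (n + m)%N = N) (i : 'I_n.+1)
    (f : cochain B n.+1) (g : cochain B m.+1) :
  graded (circ eN i f g) = pcomp P Q (graded f) (graded g) i.
Proof.
apply/funext=> x; rewrite /pcomp /graded /= /circ_family !splice_map /=.
have twist1 h : (fun j => (iter m (twist h) (x j)).1) = (fun j => (x j).1).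
  by apply/funext=> j; rewrite iter_twist.
have twist2 h : (fun j => (iter m (twist h) (x j)).2) =
    (fun j => iter m (h (x j).1) (x j).2).
  by apply/funext=> j; rewrite iter_twist.
have le_in : (i <= n)%N by rewrite -ltnS.
by rewrite !twist1 !twist2 -(mprod_splice _ eN le_in).
Qed.

Definition coface_cochain n (i : nat) (f : cochain B n.+1) : cochain B n.+2 :=
  if i is i'.+1 then
    if (i' <= n)%N then circ (addnC n 1) (inord i') f (alg_mu B)
    else circ (erefl (1 + n)%N) ord0 (alg_mu B) f
  else circ (erefl (1 + n)%N) ord_max (alg_mu B) f.

Lemma graded_alg_mu_assoc :
  pcomp P Q (graded (alg_mu B)) (graded (alg_mu B)) 0 =
  pcomp P Q (graded (alg_mu B)) (graded (alg_mu B)) 1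
    :> (('I_3 -> Omega * A) -> Omega * A).
Proof.
apply: etrans (esym (graded_circ _ ord0 _ _)) (etrans _ (graded_circ _ ord_max _ _)).
congr (graded (cochain_val _)); apply: cochain_eqP => al a /=.
rewrite /circ_family /=.
rewrite /splice /block /= /mprod !big_ord_recl !big_ord0 /= !mulg1.
exact/esym/bh_mu_assoc.
Qed.

Lemma graded_coface_cochain n i (f : cochain B n.+1) :
  graded (coface_cochain i f) = coface P Q (graded (alg_mu B)) i (graded f).
Proof.
case: i => [|i] /=; first exact: (graded_circ (erefl (1 + n)%N) ord_max (alg_mu B) f).
case: leqP => [le_in|_]; last exact: (graded_circ (erefl (1 + n)%N) ord0 (alg_mu B) f).
by rewrite graded_circ inordK.
Qed.

Lemma coface_cochain_linear n i : linear (@coface_cochain n i).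
Proof.
move=> c f g; case: i => [|i] /=; first exact: circ_linearr.
by case: leqP => _; [exact: circ_linearl | exact: circ_linearr].
Qed.

HB.instance Definition _ n i :=
  GRing.isLinear.Build k (cochain B n.+1) (cochain B n.+2) _
    (@coface_cochain n i) (@coface_cochain_linear n i).

(** In the bracket mu o_1 f, mu o_0 f and f o_i mu have the coefficients
(-1)^n, 1 and -(-1)^n (-1)^i; the factor (-1)^|f| = (-1)^n turns them into
1, (-1)^(n+2) and (-1)^(i+1). *)
Lemma delta_alg_cofaces n (f : cochain B n.+1) :
  delta_alg f = \sum_(i < n.+3) (-1) ^+ i *: coface_cochain i f.
Proof.
rewrite big_ord_recl big_ord_recr expr0 scale1r.
have -> : coface_cochain (bump 0 n.+1) f = circ (erefl (1 + n)%N) ord0 (alg_mu B) f.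
  by rewrite /= ltnn.
under eq_bigr => i _.
  have -> : coface_cochain (lift ord0 (widen_ord (leqnSn n.+1) i)) f =
      circ (addnC n 1) i f (alg_mu B).
    by rewrite /= -ltnS ltn_ord inord_val.
  over.
rewrite /delta_alg /bracket [X in X - _]big_ord_recl big_ord1.
rewrite (_ : lift ord0 ord0 = ord_max); last exact: val_inj.
rewrite !(mul1n, muln0, muln1) scalerBr scalerDr !scalerA.
rewrite -!exprD addn0 addnn -mul2n exprM sqrrN !expr1n !scale1r.
rewrite [X in X - _]addrC -!addrA; congr (_ + _).
rewrite addrC -sumrN; congr (_ + _).
  by apply: eq_bigr => i _; rewrite mul1n exprS mulN1r scaleNr.
by rewrite [RHS]/= !exprS !mulN1r opprK.
Qed.

Lemma coface_cochain_coface n (f : cochain B n.+1) i j :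
    (i < j)%N -> (j <= n.+3)%N ->
  coface_cochain j (coface_cochain i f) =
  coface_cochain i (coface_cochain j.-1 f).
Proof.
move=> lt_ij le_jn; apply: graded_inj; rewrite !graded_coface_cochain.
have [fP fQ] := graded_commutes f; have [muP muQ] := graded_commutes (alg_mu B).
apply: coface_coface => //; last exact: graded_alg_mu_assoc.
by move=> x; rewrite /twist /= bh_pq.
Qed.

Lemma delta_alg_square n (f : cochain B n.+1) :
  delta_alg (delta_alg f) = 0.
Proof.
rewrite !delta_alg_cofaces.
rewrite -[RHS](@alternating_double_sum _ _ n.+3
  (fun j i => coface_cochain j (coface_cochain i f))); last first.
  by move=> i j; apply: coface_cochain_coface.
apply: eq_bigr => j _; rewrite linear_sum scaler_sumr; apply: eq_bigr => i _.
by rewrite linearZ scalerA -exprD addnC.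
Qed.

End CochainCofaces.

Theorem proposition3p10 (k : comPzRingType) (Omega : monoidType)
    (A : lmodType k) (B : bihom_algebra Omega A) :
  (forall x : cochain_sum B, delta_sum (delta_sum x) = 0) /\
  (forall (n : nat) (f : cochain B n.+1) (al : 'I_n.+2 -> Omega)
          (a : 'I_n.+2 -> A),
     delta_alg f al a = coboundary f al a).
Proof.
split=> [x|n f al a].
  apply: cochain_sum_eqP => -[|[|n]] //=; first exact: linear0.
  exact: delta_alg_square.
(* Evaluation at (al, a) turns the sum of cofaces into the sum of values. *)
pose ev (g : cochain B n.+2) := g al a.
have ev0 : ev 0 = 0 by [].
have evD : {morph ev : g h / g + h} by [].
have evZ c g : ev (c *: g) = c *: ev g by [].
rewrite -/(ev _) delta_alg_cofaces (big_morph ev evD ev0).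
under eq_bigr do rewrite evZ.
rewrite big_ord_recl big_ord_recr expr0 scale1r /coboundary addrA /=.
rewrite /ev /=; congr (_ + _ + _).
- by rewrite /circ_family /splice /= (inord_val (ord0 : 'I_n.+2)).
- apply: eq_bigr => i _; congr (_ *: _); rewrite -ltnS ltn_ord inord_val.
  rewrite /= /circ_family /= /block /= addn0 addn1.
  by rewrite /mprod big_ord_recl big_ord1 /= addn0 /bump addn1.
rewrite ltnn /= /circ_family /splice /=.
by rewrite (inord_val (ord_max : 'I_n.+2)).
Qed.
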